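(* There is an absolute constant $C$ such that every finite simple connected $3$-colorable graph $G$ of order $n$ with minimum degree $\delta(G)\ge 8$ satisfies $$\operatorname{diam}(G)\le \frac{2}{7}n+C .$$
   Context: All graphs are finite and simple. $\operatorname{diam}(G)$ is the maximum distance between two vertices of $G$; $3$-colorable means that the chromatic number satisfies $\chi(G)\le 3$. *)

(* Defs.v *)
From mathcomp Require Import all_boot all_order all_algebra.

Set Implicit Arguments.
Unset Strict Implicit.
Unset Printing Implicit Defensive.

Record sgraph := SGraph {
  vertex :> finType;
  adj : rel vertex;
  adj_sym : symmetric adj;
  adj_irr : irreflexive adj }.

Arguments adj {s}.

Definition connected (G : sgraph) : Prop := forall x y : G, connect adj x y.

Definition degree (G : sgraph) (x : G) : nat := #|[set y | adj x y]|.

(* A degree is less than #|G|, so the default value #|G| of the minimum is used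
   only for the graph without vertices, whose minimum degree is 0. *)
Definition min_degree (G : sgraph) : nat :=
  \big[minn/#|G|]_(x : G) degree x.

Definition walk_of_length (G : sgraph) (x y : G) (k : nat) : bool :=
  [exists p : k.-tuple G, path adj x p && (last x p == y)].

(* A shortest walk has at most #|G| vertices, hence length less than #|G|;
   the value #|G| is taken exactly when y cannot be reached from x. *)
Definition dist (G : sgraph) (x y : G) : nat :=
  \big[minn/#|G|]_(k < #|G| | walk_of_length x y k) k.

Definition diam (G : sgraph) : nat := \max_(x : G) \max_(y : G) dist x y.

Definition colorable (G : sgraph) (k : nat) : bool :=
  [exists f : {ffun G -> 'I_k}, forall x, forall y, adj x y ==> (f x != f y)].

Lemma ex_colorable (G : sgraph) : exists k, colorable G k.
Proof.
exists #|G|; apply/existsP; exists [ffun x => enum_rank x].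
apply/forallP=> x; apply/forallP=> y; apply/implyP=> xy.
rewrite !ffunE (inj_eq enum_rank_inj).
by apply: contraTneq xy => ->; rewrite adj_irr.
Qed.

Definition chromatic_number (G : sgraph) : nat := ex_minn (ex_colorable G).

(* Main.v *)
(* Split the vertices by their distance from an end of a diametral path, and
   each such layer into its three colour classes.  A vertex of a layer has its
   neighbours in this layer and the two adjacent ones, and none of its own
   colour.  This yields inequalities between the sizes x, y, z of three
   consecutive layers that depend on the middle and the last layer only through
   a type in {0, 1, 2}: the number of vertices outside a largest colour class,
   truncated at 2.  Up to truncation of the sizes at 10 there are finitely many
   such configurations, and an amortized analysis with a bounded potential
   shows that the layers have at least 7/2 vertices on average. *)
Require Import Defs.
From mathcomp Require Import all_boot all_order all_algebra.
From mathcomp Require Import zify lra.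

Set Implicit Arguments.
Unset Strict Implicit.

Import Order.TTheory GRing.Theory Num.Theory.

(** * Inequalities between three consecutive layers *)

Definition layer_type (a b c : nat) : nat :=
  minn 2 (a + b + c - maxn a (maxn b c)).

Lemma layer_type_ltn (a b c : nat) :
  0 < a + b + c -> layer_type a b c < minn 3 (a + b + c).
Proof. rewrite /layer_type; lia. Qed.

(* [x], [y], [z] are the sizes of consecutive layers, and [t], [u] the types of
   the last two.  A layer of type 2 has three colours, giving the first
   disjunct by summing over a vertex of each colour, or two, giving the second. *)
Definition feasible (x y t z u : nat) : bool :=
  match t with
  | 0 => 8 <= x + z
  | 1 => (7 <= x + z) && (16 + u <= 2 * (x + z) + y)
  | _ => (12 <= x + y + z) || (16 + u <= 2 * (x + z) + y)
  end.

Lemma layers_feasible (xa xb xc ya yb yc za zb zc : nat) :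
  (0 < ya -> 8 <= xb + xc + (yb + yc) + (zb + zc)) ->
  (0 < yb -> 8 <= xa + xc + (ya + yc) + (za + zc)) ->
  (0 < yc -> 8 <= xa + xb + (ya + yb) + (za + zb)) ->
  0 < ya + yb + yc ->
  feasible (xa + xb + xc) (ya + yb + yc) (layer_type ya yb yc)
           (za + zb + zc) (layer_type za zb zc).
Proof.
move=> hA hB hC hy.
(* For a middle layer with exactly two colours, adding their degree bounds counts twice only outer
   vertices of the third colour; at least [u] vertices of the last layer are not of that colour,
   hence [16 + u]. *)
have: layer_type za zb zc <= minn (za + zb) (minn (za + zc) (zb + zc)).
  by rewrite /layer_type; lia.
have: layer_type za zb zc <= 2 by rewrite /layer_type; lia.
move: (layer_type za zb zc) => u u2 hu.
by case Et: (layer_type ya yb yc) => [|[|t]]; rewrite /layer_type in Et;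
  rewrite /=; lia.
Qed.

(** * The potential and its finite verification *)

(* The entry at [t], [y], [x] is the greatest value of the sum of [7 - 2 * s]
   over the sizes [s] of the layers that can follow two layers of sizes [x] and
   [y], the second one of type [t]; it was found by value iteration.  Sizes
   above 10 (for [y]) or 7 (for [x]) do not change it.  Columns and rows of
   impossible sizes (0, or [y <= t]) are placeholders. *)
Definition potential_table : seq (seq (seq nat)) :=
  [:: [:: [::];
          [:: 0; 0; 0; 1; 2; 2; 3; 5];
          [:: 0; 0; 1; 2; 3; 4; 4; 5];
          [:: 0; 1; 2; 3; 4; 5; 5; 6];
          [:: 0; 3; 3; 4; 5; 6; 6; 7];
          [:: 0; 3; 3; 4; 6; 6; 7; 7];
          [:: 0; 3; 3; 4; 6; 7; 8; 8];
          [:: 0; 3; 3; 4; 6; 7; 8; 10];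
          [:: 0; 3; 3; 4; 6; 7; 8; 10];
          [:: 0; 3; 3; 4; 6; 7; 8; 10];
          [:: 0; 3; 3; 4; 6; 7; 8; 10]];
      [:: [::]; [::];
          [:: 0; 0; 1; 2; 3; 4; 5; 5];
          [:: 0; 1; 3; 4; 5; 5; 6; 6];
          [:: 0; 3; 4; 5; 6; 6; 7; 7];
          [:: 0; 3; 4; 6; 6; 7; 7; 7];
          [:: 0; 3; 4; 6; 7; 8; 8; 8];
          [:: 0; 3; 4; 6; 7; 8; 10; 10];
          [:: 0; 3; 4; 6; 7; 8; 10; 10];
          [:: 0; 3; 4; 6; 7; 8; 10; 10];
          [:: 0; 3; 4; 6; 7; 8; 10; 10]];
      [:: [::]; [::]; [::];
          [:: 0; 1; 3; 4; 5; 5; 6; 6];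
          [:: 0; 3; 4; 5; 6; 7; 7; 7];
          [:: 0; 4; 5; 6; 7; 7; 7; 7];
          [:: 0; 5; 6; 7; 8; 8; 8; 8];
          [:: 0; 6; 7; 8; 10; 10; 10; 10];
          [:: 0; 7; 8; 10; 10; 10; 10; 10];
          [:: 0; 8; 10; 10; 10; 10; 10; 10];
          [:: 0; 10; 10; 10; 10; 10; 10; 10]]].

Definition potential (x y t : nat) : nat :=
  nth 0 (nth [::] (nth [::] potential_table t) (minn y 10)) (minn x 7).

Lemma potential_cap (x y t : nat) :
  potential (minn x 10) (minn y 10) t = potential x y t.
Proof. by rewrite /potential -!minnA. Qed.

Lemma potential_le10 (x y t : nat) : potential x y t <= 10.
Proof.
have nthP (s : seq nat) i : all (fun k => k <= 10) s -> nth 0 s i <= 10.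
  by move=> hs; have [/(all_nthP 0 hs)|/(nth_default 0)->] := ltnP i (size s).
apply: nthP.
have table10 : all (all (all (fun k => k <= 10))) potential_table by [].
have [ht | ht] := ltnP t (size potential_table); last first.
  by rewrite (nth_default [::] ht) nth_nil.
have /(all_nthP [::]) row10 := all_nthP [::] table10 t ht.
have [/row10 // | hy] := ltnP (minn y 10) (size (nth [::] potential_table t)).
by rewrite (nth_default [::] hy).
Qed.

Definition sizes : seq nat := iota 1 10.

Lemma potential_check :
  all (fun t => all (fun u => all (fun y => (t < y) ==>
    all (fun z => (u < z) ==> all (fun x =>
      feasible x y t z u ==> (potential y z u + 7 <= 2 * z + potential x y t))
    sizes) sizes) sizes) (iota 0 3)) (iota 0 3).
Proof. by vm_compute. Qed.

(** A size of 10 is already enough: with two other positive sizes it reaches 12, and for type 1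
    either [x + z] is at least 10, or [y] is at least 10 and [x + z] at least 7. *)
Lemma feasible_cap (x y t z u : nat) :
  0 < x -> t < minn 3 y -> u < minn 3 z ->
  feasible x y t z u -> feasible (minn x 10) (minn y 10) t (minn z 10) u.
Proof. by case: t => [|[|t]] /=; lia. Qed.

Lemma potential_step (x y t z u : nat) :
  0 < x -> t < minn 3 y -> u < minn 3 z -> feasible x y t z u ->
  potential y z u + 7 <= 2 * z + potential x y t.
Proof.
move=> x0 ty uz /(feasible_cap x0 ty uz) F.
have inS n : 0 < n -> minn n 10 \in sizes by rewrite mem_iota; lia.
have /allP/(_ t) := potential_check; rewrite mem_iota => /(_ ltac:(lia)).
move=> /allP/(_ u); rewrite mem_iota => /(_ ltac:(lia)).
move=> /allP/(_ (minn y 10) (inS y ltac:(lia)))/implyP/(_ ltac:(lia)).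
move=> /allP/(_ (minn z 10) (inS z ltac:(lia)))/implyP/(_ ltac:(lia)).
move=> /allP/(_ (minn x 10) (inS x ltac:(lia)))/implyP/(_ F).
(* Passing from [minn z 10] back to [z] only weakens the inequality. *)
by rewrite !potential_cap; lia.
Qed.

(** * Amortized bound over all layers *)

Lemma layers_weight (c : nat -> 'I_3 -> nat) (D : nat) :
  (forall i, i <= D -> 0 < \sum_k c i k) ->
  (forall i k, i.+1 < D -> 0 < c i.+1 k ->
     8 <= \sum_(l | l != k) (c i l + c i.+1 l + c i.+2 l)) ->
  7 * D <= 2 * (\sum_(i < D.+1) \sum_k c i k) + 17.
Proof.
move=> c_gt0 c_deg.
pose r k : 'I_3 := inord k; pose s i := \sum_k c i k.
have sumE F : \sum_l F l = F (r 0) + F (r 1) + F (r 2) :> nat.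
  rewrite !big_ord_recl big_ord0 addn0 addnA.
  by congr (F _ + F _ + F _); apply/val_inj; rewrite /= inordK.
have sumNE k F : \sum_(l | l != r k) F l + F (r k) = F (r 0) + F (r 1) + F (r 2).
  by rewrite -sumE [RHS](bigD1 (r k)) //= addnC.
have sE i : s i = c i (r 0) + c i (r 1) + c i (r 2) by rewrite /s sumE.
pose t i := layer_type (c i (r 0)) (c i (r 1)) (c i (r 2)).
have s_gt0 i : i <= D -> 0 < c i (r 0) + c i (r 1) + c i (r 2).
  by move=> /c_gt0; rewrite -/(s i) sE.
have step i : i.+1 < D ->
    potential (s i.+1) (s i.+2) (t i.+2) + 7
      <= 2 * s i.+2 + potential (s i) (s i.+1) (t i.+1).
  move=> iD; apply: potential_step; rewrite ?sE ?layer_type_ltn ?s_gt0 //; try lia.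
  apply: layers_feasible; last by rewrite s_gt0 //; lia.
  - by move=> /(c_deg i (r 0) iD); have := sumNE 0 (fun l => c i l + c i.+1 l + c i.+2 l); lia.
  - by move=> /(c_deg i (r 1) iD); have := sumNE 1 (fun l => c i l + c i.+1 l + c i.+2 l); lia.
  - by move=> /(c_deg i (r 2) iD); have := sumNE 2 (fun l => c i l + c i.+1 l + c i.+2 l); lia.
(* The potential starts at no more than 10, and every layer after the first two contributes one
   [step]. *)
have tele m : m < D -> potential (s m) (s m.+1) (t m.+1) + 7 * m
    <= 2 * (\sum_(i < m.+2) s i) + 10.
  elim: m => [_ | m IH mD]; first by have := potential_le10 (s 0) (s 1) (t 1); lia.
  by have := step m mD; have := IH (ltnW mD); rewrite [in X in _ -> _ -> X]big_ord_recr /=; lia.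
(* A positive [D] gives only [D - 1] terms 7, so the constant is 10 + 7 = 17. *)
case: D {c_gt0 c_deg s_gt0 step} tele => [|D] tele; first by lia.
by move: (tele D (ltnSn D)); rewrite /s; lia.
Qed.

(** * Minimum degree, colourings and distances *)

Lemma min_degree_le (G : sgraph) (x : G) : min_degree G <= degree x.
Proof. by rewrite /min_degree -minEnat -leEnat bigmin_le. Qed.

Lemma chromatic_colorable (G : sgraph) (k : nat) :
  chromatic_number G <= k -> colorable G k.
Proof.
rewrite /chromatic_number; case: ex_minnP => m /existsP[f /forallP f_proper] _ mk.
apply/existsP; exists [ffun x => widen_ord mk (f x)].
apply/forallP=> x; apply/forallP=> y; apply/implyP=> xy; rewrite !ffunE.
by have /forallP/(_ y)/implyP/(_ xy) := f_proper x.
Qed.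

Section Distance.

Variable G : sgraph.
Implicit Types x y z : G.

Lemma walkP x y k :
  reflect (exists p : seq G, [/\ size p = k, path adj x p & last x p = y])
          (walk_of_length x y k).
Proof.
apply: (iffP existsP) => [[p /andP[xp /eqP py]] | [p [pk xp py]]].
  by exists p; rewrite size_tuple.
by exists (Tuple (introT eqP pk)); rewrite /= xp py /=.
Qed.

Lemma dist_le_walk x y k : walk_of_length x y k -> dist x y <= k.
Proof.
move=> w; rewrite /dist -minEnat -leEnat; have [kG | Gk] := ltnP k #|G|.
  by apply: (bigmin_le_cond _ (j := Ordinal kG)).
by apply: le_trans (bigmin_le_id _ _ _ _) _; rewrite leEnat.
Qed.

Lemma walk_dist x y : connect adj x y -> walk_of_length x y (dist x y).
Proof.
move=> /connectP[p0 p0P ->]; case/shortenP: p0P => p xp up _ {p0}.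
have pG : size p < #|G| by have := max_card (mem (x :: p)); rewrite (card_uniqP up).
have w : walk_of_length x (last x p) (size p) by apply/walkP; exists p.
have := dist_le_walk w; move: (last x p) w => z w le_p.
(* The minimum is its default or the length of a walk; the duplicate-free path, shorter than [#|G|],
   excludes the default. *)
have : dist x z = #|G| \/ walk_of_length x z (dist x z).
  rewrite /dist; apply: (big_ind (fun m => m = #|G| \/ walk_of_length x z m)).
  - by left.
  - by move=> m n; case: (leqP m n).
  - by move=> i wi; right.
by case=> // E; move: le_p; rewrite E leqNgt pG.
Qed.

Lemma dist_adj x y z :
  connect adj x y -> adj y z -> dist x z <= (dist x y).+1.
Proof.
move=> /walk_dist/walkP[p [pk xp py]] yz; apply: dist_le_walk; apply/walkP.
exists (rcons p z); split; first by rewrite size_rcons pk.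
  by rewrite rcons_path xp py.
by rewrite last_rcons.
Qed.

(** The witness is the last vertex but one of a shortest walk. *)
Lemma dist_pred x y d : connected G -> dist x y = d.+1 -> exists z, dist x z = d.
Proof.
move=> cG dE; have /walkP[p [pk xp py]] := walk_dist (cG x y).
rewrite dE in pk; move: pk xp py dE; case/lastP: p => [//|p y'].
rewrite size_rcons rcons_path last_rcons => pk /andP[xp e] <- dE.
exists (last x p); apply/eqP; rewrite eqn_leq; apply/andP; split.
  by apply: dist_le_walk; apply/walkP; exists p; split=> //; lia.
by have := dist_adj (cG x (last x p)) e; lia.
Qed.

Lemma dist_layer x y i : connected G -> i <= dist x y -> exists z, dist x z = i.
Proof.
move=> cG; move Ed: (dist x y) => d; elim: d => [|d IH] in y Ed *.
  by rewrite leqn0 => /eqP->; exists y.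
rewrite leq_eqVlt => /predU1P[->|]; first by exists y.
by have [z /IH] := dist_pred cG Ed.
Qed.

End Distance.

(** * Distance layers and their colour classes *)

Definition color_layer (G : sgraph) (f : G -> 'I_3) (x : G) (i : nat) (l : 'I_3) :
  {set G} := [set v | (dist x v == i) && (f v == l)].

Lemma degree_layers (G : sgraph) (f : G -> 'I_3) (x v : G) (i : nat) :
  connected G -> (forall u w, adj u w -> f u != f w) -> dist x v = i.+1 ->
  degree v <= \sum_(l | l != f v) \sum_(j < 3) #|color_layer f x (i + j) l|.
Proof.
move=> cG f_proper vi.
have -> : \sum_(l | l != f v) \sum_(j < 3) #|color_layer f x (i + j) l| =
    \sum_(w : G) \sum_(l | l != f v) \sum_(j < 3) (w \in color_layer f x (i + j) l).
  rewrite [RHS]exchange_big; apply: eq_bigr => l _.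
  rewrite [RHS]exchange_big; apply: eq_bigr => j _.
  by rewrite -sum1_card big_mkcond.
rewrite /degree -sum1_card big_mkcond; apply: leq_sum => w _; rewrite inE.
case: ifP => // vw.
have d1 := dist_adj (cG x v) vw; have d2 := dist_adj (cG x w) (etrans (adj_sym w v) vw).
(* Since [dist x w] lies between [i] and [i + 2], the truncated subtraction is exact and indexes the
   layer of [w]. *)
have jP : dist x w - i < 3 by lia.
rewrite (bigD1 (f w)) 1?eq_sym ?f_proper //= (bigD1 (Ordinal jP)) //= inE eqxx.
by have -> : dist x w == i + (dist x w - i) by lia.
Qed.

Lemma dist_bound (G : sgraph) (x y : G) :
  connected G -> chromatic_number G <= 3 -> 8 <= min_degree G ->
  7 * dist x y <= 2 * #|G| + 17.
Proof.
move=> cG /chromatic_colorable/existsP[f /forallP f_col] deg8.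
have f_proper u v : adj u v -> f u != f v by have /forallP/(_ v)/implyP := f_col u.
pose c i l := #|color_layer f x i l|.
have s_card i : \sum_l c i l = #|[set v | dist x v == i]|.
  rewrite -sum1_card (partition_big f xpredT) //; apply: eq_bigr => l _.
  by rewrite /c -sum1_card; apply: eq_bigl => v; rewrite !inE.
(* Vertices farther from [x] than [y] is lie in none of these layers. *)
have total : \sum_(i < (dist x y).+1) \sum_l c i l <= #|G|.
  rewrite -sum1_card (eq_bigr (fun i : 'I__ => \sum_(v : G) (dist x v == i : nat))); last first.
    move=> i _; rewrite s_card -sum1_card big_mkcond.
    by apply: eq_bigr => v _; rewrite inE.
  rewrite exchange_big; apply: leq_sum => v _ /=.
  have [vD|Dv] := ltnP (dist x v) (dist x y).+1.
    rewrite (bigD1 (Ordinal vD)) //= eqxx big1 // => i.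
    by rewrite -val_eqE /= eq_sym => /negbTE ->.
  by rewrite big1 // => i _; rewrite gtn_eqF // (leq_trans _ Dv).
apply: leq_trans (_ : 2 * (\sum_(i < (dist x y).+1) \sum_l c i l) + 17 <= _); last first.
  by rewrite leq_add2r leq_mul2l.
apply: layers_weight => [i iD | i l _].
  by rewrite s_card card_gt0; apply/set0Pn; have [z zi] := dist_layer cG iD;
    exists z; rewrite inE zi.
rewrite card_gt0 => /set0Pn[v]; rewrite inE => /andP[/eqP vi /eqP <-].
apply: leq_trans (leq_trans deg8 (min_degree_le v)) _.
apply: leq_trans (degree_layers cG f_proper vi) _.
apply: leq_sum => l' _.
by rewrite !big_ord_recl big_ord0 /= addnA /bump /= !addn0 addn1 addn2.
Qed.

Local Open Scope ring_scope.

Theorem proposition16 :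
  exists C : rat, forall G : sgraph,
    connected G ->
    (chromatic_number G <= 3)%N ->
    (8 <= min_degree G)%N ->
    (diam G)%:R <= 2 / 7 * #|G|%:R + C.
Proof.
exists (17 / 7) => G cG col deg.
have bound : (7 * diam G <= 2 * #|G| + 17)%N.
  (* The rounded quotient isolates the maximum, so that it can be bounded pair by pair. *)
  have : (diam G <= (2 * #|G| + 17) %/ 7)%N.
    apply/bigmax_leqP => x _; apply/bigmax_leqP => y _.
    by rewrite leq_divRL // mulnC dist_bound.
  by rewrite leq_divRL // mulnC.
move: bound; rewrite -(ler_nat rat) natrD !natrM; lra.
Qed.
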